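(* Let $\mathcal{X}$ be a curve of genus $g$ over $\mathbb{F}_q$, let $Q,P_1,\dots,P_n$ be distinct rational points of $\mathcal{X}$ with $n>2g+2$, and let $D=P_1+\dots+P_n$. For every non-negative integer $m$, the minimum distance of the one-point code $C(D,mQ)$ satisfies $$d(C(D,mQ))\ \geq\ d^*\bigl(\dim (C(D,mQ))\bigr).$$
   Context: ''Curve'' means projective, non-singular, geometrically irreducible algebraic curve. For a divisor $E$, $\mathcal{L}(E)$ is its Riemann–Roch space. Let $v=-v_Q$, where $v_Q$ is the valuation at $Q$, and $\mathcal{L}(\infty Q)=\bigcup_{r\ge 0}\mathcal{L}(rQ)$. The evaluation map is $ev:\mathcal{L}(\infty Q)\to\mathbb{F}_q^n$, $ev(f)=(f(P_1),\dots,f(P_n))$, and $C(D,mQ)=ev(\mathcal{L}(mQ))$ (so $C(D,-Q)=(0)$). The Weierstrass semigroup is $H=H(Q)=\{v(f): f\in\mathcal{L}(\infty Q)\setminus\{0\}\}$. Let $$H^*=\{m\in\mathbb{N}_0 : C(D,mQ)\neq C(D,(m-1)Q)\}.$$ The set $H^*$ has exactly $n$ elements; write $H^*=\{m_1<m_2<\dots<m_n\}$. For $i=1,\dots,n$ put $$\Lambda_i^*=\{m\in H^* : m=m_i+m_j \text{ for some } m_j\in H^*\}$$ (equivalently $\Lambda^*_i=(m_i+H)\cap H^*$), and $$d^*(i)=\min\{\#\Lambda_r^* : 1\le r\le i\}.$$ *)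

(* Defs.v *)
From mathcomp Require Import all_boot all_order all_algebra.
From mathcomp Require Import fraction boolp classical_sets cardinality finmap.
From mathcomp Require Import freeg mpoly.

Set Implicit Arguments.
Unset Strict Implicit.
Unset Printing Implicit Defensive.

Import GRing.Theory.
Local Open Scope ring_scope.
Local Open Scope classical_set_scope.

(* A curve over F_q is given by its points in P^N(K), where K is an algebraic
   closure of F_q, as the common zeros of forms with coefficients in F_q; its
   rational functions are quotients of forms of the same degree. *)

(* Every point of P^N(K) has exactly one vector of homogeneous coordinates
   whose first nonzero entry is 1. *)
Definition normalized (K : fieldType) (N : nat) (p : {ffun 'I_N.+1 -> K}) :=
  [exists i, (p i == 1) && [forall j : 'I_N.+1, (j < i)%N ==> (p j == 0)]].

Definition proj_point (K : fieldType) (N : nat) :=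
  {p : {ffun 'I_N.+1 -> K} | normalized p}.

Section Geometry.
Context {K : closedFieldType} {N : nat}.

Local Notation point := (proj_point K N).
Local Notation form := {mpoly K[N.+1]}.
Local Notation frac := {fraction {mpoly K[N.+1]}}.

Definition peval (F : form) (P : point) : K := F.@[val P].

Definition zeros (s : seq form) : set point :=
  fun P => forall F, F \in s -> peval F P = 0.

Definition zariski_closed (Z : set point) :=
  exists s : seq form,
    (forall F, F \in s -> exists d, F \is d.-homog) /\ Z = zeros s.

Definition irreducible (Z : set point) :=
  Z !=set0 /\
  forall A B, zariski_closed A -> zariski_closed B ->
    Z `<=` A `|` B -> Z `<=` A \/ Z `<=` B.

Definition closed_chain (X : set point) (d : nat) :=
  exists Z : nat -> set point,
    [/\ forall i, (i <= d)%N -> zariski_closed (Z i) /\ irreducible (Z i),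
        forall i, (i <= d)%N -> Z i `<=` X
      & forall i, (i < d)%N -> Z i `<` Z i.+1].

(* Krull dimension *)
Definition has_dim (X : set point) (d : nat) :=
  closed_chain X d /\ ~ closed_chain X d.+1.

Section FunctionField.
Variable X : set point.

Definition vanishes_on (F : form) := forall P, X P -> peval F P = 0.

Definition quot (F G : form) : frac := tofrac F / tofrac G.

(* For X irreducible, the function field K(X) is the ring of the fractions
   satisfying [ratfun] modulo its maximal ideal [null]; we compute with
   representatives, and [eqX] is equality in K(X). *)
Definition ratfun (f : frac) :=
  exists d F G, [/\ F \is d.-homog, G \is d.-homog,
                    ~ vanishes_on G & f = quot F G].

Definition null (f : frac) :=
  exists d F G, [/\ F \is d.-homog, G \is d.-homog,
                    ~ vanishes_on G, vanishes_on F & f = quot F G].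

Definition eqX (f h : frac) := null (f - h).

(* f is regular at P (in X), with f(P) = c *)
Definition value_at (P : point) (f : frac) (c : K) :=
  exists d F G, [/\ F \is d.-homog, G \is d.-homog, peval G P != 0,
                    eqX f (quot F G) & c = peval F P / peval G P].

Definition regular_at (P : point) (f : frac) := exists c, value_at P f c.

(* t generates the maximal ideal M_P of the local ring O_P *)
Definition uniformizer (P : point) (t : frac) :=
  value_at P t 0 /\
  forall f, value_at P f 0 ->
    exists h, regular_at P h /\ eqX f (t * h).

(* O_P is a regular local ring of dimension 1 at every point P *)
Definition nonsingular_curve :=
  has_dim X 1 /\ forall P, X P -> exists t, uniformizer P t.

(* v_P(f) >= d, where v_P(f) = sup {d | f \in M_P^d} and M_P^d = t^d O_P;
   in particular this holds for all d when f = 0. *)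
Definition val_ge (P : point) (f : frac) (d : int) :=
  exists t h, [/\ uniformizer P t, regular_at P h & eqX f (t ^ d * h)].

Definition divisor_on (D : {freeg point}) := forall P, P \in dom D -> X P.

Definition RR (D : {freeg point}) (f : frac) :=
  ratfun f /\ forall P, X P -> val_ge P f (- coeff P D).

Definition cst (c : K) : frac := tofrac c%:MP_[N.+1].

Definition RR_dim (D : {freeg point}) (l : nat) :=
  exists b : 'I_l -> frac,
    [/\ forall i, RR D (b i),
        forall f, RR D f -> exists c, eqX f (\sum_i cst (c i) * b i)
      & forall c, null (\sum_i cst (c i) * b i) -> forall i, c i = 0].

(* g = max_D (deg D + 1 - l(D)) *)
Definition has_genus (g : nat) :=
  (forall D l, divisor_on D -> RR_dim D l -> deg D + 1 - l%:Z <= g%:Z) /\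
  (exists D l, [/\ divisor_on D, RR_dim D l & deg D + 1 - l%:Z = g%:Z]).

End FunctionField.
End Geometry.

Section OverFiniteField.
Context {k : finFieldType} {K : closedFieldType} (iota : {rmorphism k -> K}).
Context {N : nat}.

Definition locus (s : seq {mpoly k[N.+1]}) : set (proj_point K N) :=
  zeros (map (map_mpoly iota) s).

Definition is_curve (s : seq {mpoly k[N.+1]}) :=
  [/\ forall F, F \in s -> exists d, F \is d.-homog,
      irreducible (locus s) & nonsingular_curve (locus s)].

(* F_q-rationality is read off the normalized coordinates. *)
Definition rational_point (X : set (proj_point K N)) (P : proj_point K N) :=
  X P /\ forall i, exists a, val P i = iota a.

(* the elements of F_q(X) inside K(X) *)
Definition ratfun_over (X : set (proj_point K N))
    (f : {fraction {mpoly K[N.+1]}}) :=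
  exists d (F G : {mpoly k[N.+1]}),
    [/\ F \is d.-homog, G \is d.-homog, ~ vanishes_on X (map_mpoly iota G)
      & f = quot (map_mpoly iota F) (map_mpoly iota G)].

Section OnePointCode.
Variables (X : set (proj_point K N)) (Q : proj_point K N).
Variables (n : nat) (P : 'I_n -> proj_point K N).

(* L(mQ), as a space of functions defined over F_q *)
Definition RR_point (m : nat) (f : {fraction {mpoly K[N.+1]}}) :=
  ratfun_over X f /\ RR X << m%:Z *g Q >> f.

(* C(D,mQ) *)
Definition one_point_code (m : nat) : {set 'rV[k]_n} :=
  [set c : 'rV[k]_n | `[< exists f, RR_point m f /\
                 forall i, value_at X (P i) f (iota (c 0 i)) >]]%SET.

(* C(D,(m-1)Q), with C(D,-Q) = (0) *)
Definition one_point_code_pred (m : nat) : {set 'rV[k]_n} :=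
  if m is m'.+1 then one_point_code m' else [set 0]%SET.

Definition Hstar (m : nat) : bool :=
  one_point_code m != one_point_code_pred m.

(* The increasing enumeration of H*, which is a finite set (fset_set of an
   infinite set would be empty). *)
Definition Hstar_seq : seq nat :=
  sort leq (enum_fset (fset_set [set m | Hstar m])).

(* m_i, for 1 <= i <= #H* *)
Definition mstar (i : nat) : nat := nth 0%N Hstar_seq i.-1.

Definition Lambda_star (i : nat) : seq nat :=
  [seq m <- Hstar_seq | has (fun m' => m == mstar i + m')%N Hstar_seq].

(* min of #Lambda*_r for 1 <= r <= i; only meaningful for i >= 1 *)
Definition dstar (i : nat) : nat :=
  \big[minn/size (Lambda_star 1)]_(1 <= r < i.+1) size (Lambda_star r).

End OnePointCode.
End OverFiniteField.

Section Codes.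
Context {k : finFieldType} {n : nat}.

Definition hamming_dist (x y : 'rV[k]_n) : nat := #|[pred i | x 0 i != y 0 i]|.

(* n bounds every distance, so it does not affect the minimum as soon as C has
   two elements. *)
Definition min_dist (C : {set 'rV[k]_n}) : nat :=
  \big[minn/n]_(x in C) \big[minn/n]_(y in C | x != y) hamming_dist x y.

(* C is meant to be a linear subspace, hence equal to its span. *)
Definition code_dim (C : {set 'rV[k]_n}) : nat := \dim <<enum C>>.

End Codes.

(* Main.v *)
Require Import Defs.
From HB Require Import structures.
From mathcomp Require Import all_boot all_order all_algebra mpoly.
From mathcomp Require Import abelian finfield fraction freeg boolp zify ring.

Set Implicit Arguments.
Unset Strict Implicit.
Unset Printing Implicit Defensive.
Import GRing.Theory.
Local Open Scope ring_scope.

(* Let x be a nonzero word of C(D,mQ) and a the least pole order with x in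
   C(D,aQ); then a is in H*.  For b in H* and y in C(D,bQ) outside
   C(D,(b-1)Q), the componentwise product x*y lies in C(D,(a+b)Q), and outside
   C(D,(a+b-1)Q) if a+b is in H*, since L((a+b)Q)/L((a+b-1)Q) is at most a line
   and the product of functions with poles of exact orders a and b spans it.
   All these products are supported on the support of x, so the filtration by
   pole order, intersected with the words supported there, has at least
   #Lambda*_a jumps, while its dimension is at most the weight of x.

   Two geometric facts are needed.  A function without poles that vanishes at Q
   is zero: by the definition of the genus some L(D) is finite-dimensional, and
   multiplication by the function acts on it.  The ratio of two leading
   coefficients at Q of functions over F_q is in F_q: it is fixed by the
   Frobenius. *)

(** * Jumps of an increasing sequence of subspaces *)

Section Filtration.
Variables (k : fieldType) (vT : vectType k) (V : nat -> {vspace vT}).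
Hypothesis V_le : forall j, (V j <= V j.+1)%VS.

Definition jump (j : nat) : bool :=
  V j != (if j is j'.+1 then V j' else 0%VS).

(** Every jump raises the dimension by at least one, starting from the zero space placed before
    [V 0]. *)
Lemma count_jump_le_dim M : (count jump (iota 0 M.+1) <= \dim (V M))%N.
Proof.
elim: M => [|M IH].
  by rewrite /= addn0 /jump -dimv_eq0; case: (\dim _).
have jE : jump M.+1 = (V M.+1 != V M) by [].
rewrite -(addn1 M.+1) iotaD count_cat /= addn0 add0n jE.
have [eqV|neqV] := eqVneq (V M.+1) (V M).
  by rewrite eqV addn0.
rewrite addn1 (leq_ltn_trans IH) //.
rewrite ltn_neqAle dimvS ?V_le // andbT.
apply: contra neqV => eqd.
by rewrite eq_sym eqEdim V_le /= (eqP eqd).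
Qed.

End Filtration.

(** * The order bound for an abstract increasing family of codes *)

Section OrderBound.
Variables (k : finFieldType) (n : nat) (C : nat -> {set 'rV[k]_n}).

Definition pred_code (m : nat) : {set 'rV[k]_n} :=
  if m is m'.+1 then C m' else [set 0]%SET.

Definition code_jump (m : nat) : bool := C m != pred_code m.

Hypothesis C_add : forall m x y, x \in C m -> y \in C m -> x + y \in C m.
Hypothesis C_scale : forall m a x, x \in C m -> a *: x \in C m.
Hypothesis C_0 : forall m, 0 \in C m.
Hypothesis C_le : forall m x, x \in C m -> x \in C m.+1.

Definition schur_mul (x y : 'rV[k]_n) : 'rV[k]_n := \row_i (x 0 i * y 0 i).

(** This is what the geometry has to supply. The condition on [a + b] is forced: where there is no
    jump, the code equals its predecessor and the conclusion is contradictory. *)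
Hypothesis C_mul : forall a b x y,
  x \in C a -> x \notin pred_code a -> y \in C b -> y \notin pred_code b ->
  code_jump (a + b) ->
  schur_mul x y \in C (a + b) /\ schur_mul x y \notin pred_code (a + b).

Let W m : {vspace 'rV[k]_n} := <<enum (C m)>>%VS.

Let memW m x : (x \in W m) = (x \in C m).
Proof.
apply/idP/idP => [|xC]; last by apply: memv_span; rewrite mem_enum.
move/(@coord_span _ _ _ (in_tuple (enum (C m)))) => ->.
apply: (big_ind (fun y => y \in C m)) => [|y z|i _]; first exact: C_0.
- exact: C_add.
- by apply: C_scale; rewrite -mem_enum mem_nth // size_tuple.
Qed.

Let W_le m : (W m <= W m.+1)%VS.
Proof. by apply/subvP => x; rewrite !memW; exact: C_le. Qed.

Lemma sub_pred_code m : pred_code m \subset C m.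
Proof.
case: m => [|m]; first by apply/subsetP => x /set1P ->; exact: C_0.
by apply/subsetP => x; exact: C_le.
Qed.

Lemma code_jumpP m :
  reflect (exists2 x, x \in C m & x \notin pred_code m) (code_jump m).
Proof.
rewrite /code_jump eqEsubset sub_pred_code andbT.
exact: subsetPn.
Qed.

Let jump_code (U : {vspace 'rV[k]_n}) m x :
  x \in U -> x \in C m -> x \notin pred_code m ->
  jump (fun j => W j :&: U)%VS m.
Proof.
move=> xU xC xnC; rewrite /jump.
apply/eqP => eqW; have : x \in (W m :&: U)%VS by rewrite memv_cap memW xC.
rewrite eqW; case: m xC xnC {eqW} => [|m] xC xnC.
  by rewrite memv0 => /eqP x0; rewrite x0 set11 in xnC.
by rewrite memv_cap memW; move: xnC => /= /negPf ->.
Qed.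

Let WU_le U j : (W j :&: U <= W j.+1 :&: U)%VS.
Proof. exact: capvS. Qed.

(** The word supplied for m witnesses a jump at m of the filtration intersected with [U]. The full
    space as [U] gives the dimension of a code; the words supported on a given support give a
    weight. *)
Let count_le (U : {vspace 'rV[k]_n}) (p : pred nat) M :
  (forall m, (m <= M)%N -> p m ->
     exists x, [/\ x \in U, x \in C m & x \notin pred_code m]) ->
  (count p (iota 0 M.+1) <= \dim (W M :&: U))%N.
Proof.
move=> pP; apply: leq_trans (count_jump_le_dim (WU_le U) M).
rewrite -!size_filter; apply: uniq_leq_size.
  by rewrite filter_uniq // iota_uniq.
move=> m; rewrite !mem_filter mem_iota /= add0n => /andP[pm mM].
rewrite mM andbT; have [x [xU xC xnC]] := pP m mM pm.
exact: jump_code xU xC xnC.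
Qed.

Lemma count_code_jump_le_dim M :
  (count code_jump (iota 0 M.+1) <= code_dim (C M))%N.
Proof.
rewrite /code_dim -/(W M) -[W M]capvf; apply: count_le => m _ /code_jumpP[x xC xnC].
by exists x; rewrite memvf.
Qed.

Lemma code_dim_le m : (code_dim (C m) <= n)%N.
Proof. by rewrite (leq_trans (dimvS (subvf _))) // dimvf /dim /= mul1n. Qed.

(** The number of jumps up to m never exceeds n, so it reaches its maximum at some M, and a jump
    after M would increase it further. *)
Lemma code_jump_bounded : exists M, forall m, code_jump m -> (m <= M)%N.
Proof.
pose h m := count code_jump (iota 0 m.+1).
have hP : exists i, `[< exists m, h m = i >] by exists (h 0%N); apply/asboolP; exists 0%N.
have hle i : `[< exists m, h m = i >] -> (i <= n)%N.
  case/asboolP=> m <-; apply: leq_trans (code_dim_le m); exact: count_code_jump_le_dim.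
case: (ex_maxnP hP hle) => _ /asboolP[M <-] maxM.
exists M => m Hm; rewrite leqNgt; apply/negP => ltMm.
have : (h m <= h M)%N by apply: maxM; apply/asboolP; exists m.
rewrite /h (_ : m.+1 = M.+1 + (m - M))%N; last by lia.
rewrite iotaD count_cat -leq_subRL // subnn leqn0 -leqn0 leqNgt -has_count.
by move/hasPn/(_ m); rewrite mem_iota Hm => /(_ ltac:(lia)).
Qed.

(** A sorted list without repetition is determined by its members. The filtered form makes positions
    in the list computable as numbers of jumps. *)
Lemma code_jump_enum M (s : seq nat) :
  (forall m, code_jump m -> (m <= M)%N) ->
  sorted leq s -> uniq s -> (forall m, (m \in s) = code_jump m) ->
  s = [seq m <- iota 0 M.+1 | code_jump m].
Proof.
move=> leM s_sorted s_uniq memE.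
apply: (sorted_eq leq_trans anti_leq) => //.
  exact/sorted_filter/iota_sorted/leq_trans.
apply: uniq_perm => //; first by rewrite filter_uniq ?iota_uniq.
move=> m; rewrite memE mem_filter mem_iota /= add0n ltnS.
by case E: (code_jump m) => //=; rewrite leM.
Qed.

Definition shifted (s : seq nat) (a : nat) : seq nat :=
  [seq m <- s | has (fun m' => m == a + m')%N s].

Lemma weight_bound (s : seq nat) M a x :
  uniq s -> (forall m, (m \in s) -> (m <= M)%N) ->
  (forall m, (m \in s) = code_jump m) ->
  x \in C a -> x \notin pred_code a ->
  (size (shifted s a) <= #|[pred i | (x 0 i != 0)%R]|)%N.
Proof.
move=> s_uniq leM memE xC xnC.
pose D := shifted s a.
pose S := [pred i | x 0 i != 0].
pose e i : 'rV[k]_n := delta_mx 0 i.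
(* [U] is the space of words supported on the support of [x]. It is spanned by as many unit vectors
   as the weight of [x], and it contains every product of [x] with a word. *)
pose U := <<image e S>>%VS.
have mulU y : schur_mul x y \in U.
  rewrite (row_sum_delta (schur_mul x y)); apply: memv_suml => i _.
  rewrite mxE; have [->|xi] := eqVneq (x 0 i) 0; first by rewrite mul0r scale0r mem0v.
  by apply/memvZ/memv_span/(image_f e).
apply: (@leq_trans (\dim U)); last first.
  by apply: leq_trans (dim_span _) _; rewrite size_image.
apply: leq_trans (dimvS (capvSr (W M) U)).
apply: leq_trans (count_le (U := U) (p := mem D) _).
  rewrite -size_filter; apply: uniq_leq_size; first exact: filter_uniq.
  move=> m mD; rewrite mem_filter mem_iota /= add0n ltnS.
  apply/andP; split; first exact: mD.
  by apply: leM; move: mD; rewrite mem_filter => /andP[].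
move=> m _ mD; have : m \in D by exact: mD.
rewrite mem_filter => /andP[/hasP[b bs /eqP mE] ms].
have /code_jumpP[y yC ynC] : code_jump b by rewrite -memE.
exists (schur_mul x y); rewrite mE.
by have [] := C_mul xC xnC yC ynC _; first by rewrite -mE -memE.
Qed.

(** Take the least index whose code contains [x]. If it is 0, the predecessor is the zero code,
    which [x] avoids because it is nonzero. *)
Lemma leading_pole m x : x \in C m -> x != 0 ->
  exists2 a, (a <= m)%N & x \in C a /\ x \notin pred_code a.
Proof.
move=> xC x0; have ex : exists j, x \in C j by exists m.
case: (ex_minnP ex) => a xa amin; exists a; first exact: amin.
split=> //; case: a xa amin => [|a] xa amin /=; first by rewrite inE.
by apply/negP => /amin; rewrite ltnn.
Qed.

(** The distance of two words is the weight of their difference z. If z has exact order a, then a is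
    the r-th jump for some r at most the dimension of [C m], so [Lam r] takes part in the minimum,
    and [weight_bound] applies to z. *)
Lemma order_bound (s : seq nat) m :
  sorted leq s -> uniq s -> (forall j, (j \in s) = code_jump j) ->
  (\big[minn/size (shifted s (nth 0%N s 0))]_(1 <= r < (code_dim (C m)).+1)
      size (shifted s (nth 0%N s r.-1))
     <= min_dist (C m))%N.
Proof.
move=> s_sorted s_uniq memE; pose Lam r := shifted s (nth 0%N s r.-1).
have [M leM] := code_jump_bounded.
have sE := code_jump_enum leM s_sorted s_uniq memE.
set B := (\big[_/_]_(_ <= _ < _) _)%N.
have B_le r : (0 < r <= code_dim (C m))%N -> (B <= size (Lam r))%N.
  move=> rP; have : r \in index_iota 1 (code_dim (C m)).+1 by rewrite mem_index_iota.
  rewrite /B; elim: (index_iota _ _) => //= r' l IH.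
  by rewrite inE big_cons geq_min => /orP[/eqP ->|/IH ->]; rewrite ?leqnn ?orbT.
(* [min_dist] starts its minima from n, so n itself must be bounded below by [B]. The starting value
   of [B] is the size of [Lam 1], which is at most the number of jumps, hence at most n. *)
have Bn : (B <= n)%N.
  have B1 : (B <= size (Lam 1%N))%N.
    rewrite /B; elim: (index_iota _ _) => [|r l IH]; first by rewrite big_nil.
    by rewrite big_cons geq_min IH orbT.
  rewrite (leq_trans B1) // size_filter (leq_trans (count_size _ _)) // sE size_filter.
  exact: leq_trans (count_code_jump_le_dim M) (code_dim_le M).
rewrite /min_dist; apply: (big_ind (fun d => B <= d)%N) => //.
  by move=> d e; rewrite leq_min => -> ->.
move=> x xC; apply: (big_ind (fun d => B <= d)%N) => //.
  by move=> d e; rewrite leq_min => -> ->.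
move=> y /andP[yC xy].
have zC : x - y \in C m by rewrite C_add // -scaleN1r C_scale.
have [|a am [za zna]] := leading_pole zC; first by rewrite subr_eq0.
have ja : code_jump a by apply/code_jumpP; exists (x - y).
have as_ : a \in s by rewrite memE.
have -> : hamming_dist x y = #|[pred i | (x - y) 0 i != 0]|.
  by apply: eq_card => i; rewrite !inE !mxE subr_eq0.
apply: (leq_trans (B_le (index a s).+1 _)); last first.
  rewrite /Lam /= nth_index //; apply: (weight_bound s_uniq _ memE za zna (M := M)).
  by move=> j; rewrite memE => /leM.
rewrite /=; apply: leq_trans (count_code_jump_le_dim m).
have aM : (a <= M)%N := leM _ ja.
rewrite -size_filter.
(* Counted from 1, the position of a is the number of jumps up to a. These are among the jumps up to
   m, whose number is at most the dimension of [C m]. *)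
have -> : (index a s).+1 = size [seq j <- iota 0 a.+1 | code_jump j].
  rewrite -(addn1 a) [in RHS]iotaD filter_cat size_cat /= add0n ja addn1.
  rewrite sE (_ : M.+1 = a + (M - a).+1)%N; last by lia.
  rewrite iotaD filter_cat index_cat mem_filter mem_iota add0n ltnn !andbF.
  by rewrite /= ja /= eqxx addn0.
rewrite !size_filter (_ : m.+1 = a.+1 + (m - a))%N; last by lia.
by rewrite iotaD count_cat leq_addr.
Qed.

End OrderBound.

(** * The function field of an irreducible projective set *)

Lemma subf_inv (L : fieldType) (a b : L) : a != 0 -> b != 0 ->
  a^-1 - b^-1 = - (a - b) * (a^-1 * b^-1).
Proof. by move=> a0 b0; field; rewrite a0 b0. Qed.

Section FunctionField.
Context {K : closedFieldType} {N : nat}.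
Variable X : classical_sets.set (proj_point K N).
Hypothesis X_irr : irreducible X.

Local Notation point := (proj_point K N).
Local Notation form := {mpoly K[N.+1]}.
Local Notation frac := {fraction {mpoly K[N.+1]}}.

Lemma pevalM F G (P : point) : peval (F * G) P = peval F P * peval G P.
Proof. exact: mevalM. Qed.

Lemma pevalD F G (P : point) : peval (F + G) P = peval F P + peval G P.
Proof. exact: mevalD. Qed.

Lemma vanishes0 : vanishes_on X 0.
Proof. by move=> P _; rewrite /peval meval0. Qed.

Lemma nvanishes_neq0 F : ~ vanishes_on X F -> F != 0.
Proof. by move=> nF; apply/eqP => F0; apply: nF; rewrite F0; exact: vanishes0. Qed.

Lemma nvanishes1 : ~ vanishes_on X (1 : form).
Proof.
have [[P XP] _] := X_irr => /(_ _ XP) /eqP.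
by rewrite /peval meval1 oner_eq0.
Qed.

Lemma nvanishes_at P F : X P -> peval F P != 0 -> ~ vanishes_on X F.
Proof. by move=> XP /eqP FP /(_ _ XP). Qed.

(** The zero sets of the two forms are closed and cover [X], so by irreducibility one of them
    contains [X]. *)
Lemma vanishes_mul d e (F G : form) :
  F \is d.-homog -> G \is e.-homog -> vanishes_on X (F * G) ->
  vanishes_on X F \/ vanishes_on X G.
Proof.
move=> Fd Ge FG0.
have closed (H : form) i : H \is i.-homog -> zariski_closed (zeros [:: H]).
  by move=> Hi; exists [:: H]; split=> // H' /[!inE] /eqP ->; exists i.
have [|XF|XG] := X_irr.2 _ _ (closed _ _ Fd) (closed _ _ Ge).
- move=> P XP; have /eqP := FG0 P XP.
  by rewrite pevalM mulf_eq0 => /orP[] /eqP E; [left|right] => H /[!inE] /eqP ->.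
- by left=> P /XF; apply; rewrite inE.
- by right=> P /XG; apply; rewrite inE.
Qed.

Lemma nvanishes_mul d e (F G : form) :
  F \is d.-homog -> G \is e.-homog ->
  ~ vanishes_on X F -> ~ vanishes_on X G -> ~ vanishes_on X (F * G).
Proof. by move=> Fd Ge nF nG /(vanishes_mul Fd Ge) []. Qed.

Lemma vanishes_mulr (F G : form) : vanishes_on X F -> vanishes_on X (F * G).
Proof. by move=> F0 P XP; rewrite pevalM F0 ?mul0r. Qed.

Lemma vanishesD (F G : form) :
  vanishes_on X F -> vanishes_on X G -> vanishes_on X (F + G).
Proof. by move=> F0 G0 P XP; rewrite pevalD F0 ?G0 ?addr0. Qed.

Lemma quotD (F G F' G' : form) : G != 0 -> G' != 0 ->
  quot F G + quot F' G' = quot (F * G' + F' * G) (G * G').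
Proof.
by move=> G0 G'0; rewrite /quot addf_div ?tofrac_eq0 // rmorphD !rmorphM.
Qed.

Lemma quotM (F G F' G' : form) : quot F G * quot F' G' = quot (F * F') (G * G').
Proof. by rewrite /quot mulf_div !rmorphM. Qed.

Lemma quotN (F G : form) : - quot F G = quot (- F) G.
Proof. by rewrite /quot rmorphN mulNr. Qed.

Lemma quotV (F G : form) : (quot F G)^-1 = quot G F.
Proof. by rewrite /quot invf_div. Qed.

Lemma cst_quot (c : K) : cst c = quot c%:MP_[N.+1] 1.
Proof. by rewrite /quot tofrac1 divr1. Qed.

Lemma homogC (c : K) : c%:MP_[N.+1] \is 0.-homog.
Proof. by rewrite -[c%:MP]mulr1 mul_mpolyC dhomogZ ?dhomog1. Qed.

Lemma homog_cross d e (F G F' G' : form) :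
  F \is d.-homog -> G \is d.-homog -> F' \is e.-homog -> G' \is e.-homog ->
  F * G' + F' * G \is (d + e).-homog.
Proof.
by move=> Fd Gd Fe Ge; apply: dhomogD; [|rewrite addnC]; exact: dhomogM.
Qed.

Lemma ratfunD f h : ratfun X f -> ratfun X h -> ratfun X (f + h).
Proof.
move=> [d [F [G [Fd Gd nG ->]]]] [e [F' [G' [Fe Ge nG' ->]]]].
rewrite quotD ?nvanishes_neq0 //.
exists (d + e)%N, (F * G' + F' * G), (G * G'); split => //.
- exact: homog_cross.
- exact: dhomogM.
- exact: nvanishes_mul Gd Ge _ _.
Qed.

Lemma ratfunM f h : ratfun X f -> ratfun X h -> ratfun X (f * h).
Proof.
move=> [d [F [G [Fd Gd nG ->]]]] [e [F' [G' [Fe Ge nG' ->]]]].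
rewrite quotM; exists (d + e)%N, (F * F'), (G * G'); split => //;
  rewrite ?dhomogM //; exact: nvanishes_mul Gd Ge _ _.
Qed.

Lemma ratfun_cst c : ratfun X (cst c).
Proof.
rewrite cst_quot; exists 0%N, c%:MP, 1; split=> //.
- exact: homogC.
- exact: dhomog1.
- exact: nvanishes1.
Qed.

Lemma null_ratfun f : null X f -> ratfun X f.
Proof. by move=> [d [F [G [Fd Gd nG _ ->]]]]; exists d, F, G. Qed.

Lemma nullD f h : null X f -> null X h -> null X (f + h).
Proof.
move=> [d [F [G [Fd Gd nG F0 ->]]]] [e [F' [G' [Fe Ge nG' F'0 ->]]]].
rewrite quotD ?nvanishes_neq0 //.
exists (d + e)%N, (F * G' + F' * G), (G * G'); split => //.
- exact: homog_cross.
- exact: dhomogM.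
- exact: nvanishes_mul Gd Ge _ _.
- by apply: vanishesD; exact: vanishes_mulr.
Qed.

Lemma nullMr f h : null X f -> ratfun X h -> null X (f * h).
Proof.
move=> [d [F [G [Fd Gd nG F0 ->]]]] [e [F' [G' [Fe Ge nG' ->]]]].
rewrite quotM; exists (d + e)%N, (F * F'), (G * G'); split => //;
  rewrite ?dhomogM //; first exact: nvanishes_mul Gd Ge _ _.
exact: vanishes_mulr.
Qed.

Lemma nullMl f h : ratfun X f -> null X h -> null X (f * h).
Proof. by rewrite mulrC => rf nh; exact: nullMr. Qed.

Lemma nullN f : null X f -> null X (- f).
Proof.
move=> [d [F [G [Fd Gd nG F0 ->]]]]; rewrite quotN.
exists d, (- F), G; split => //; first by rewrite dhomogN.
by move=> P XP; rewrite /peval mevalN -/(peval F P) F0 ?oppr0.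
Qed.

Lemma null0 : null X 0.
Proof.
exists 0%N, 0, 1; split; [exact: dhomog0|exact: dhomog1|exact: nvanishes1| |].
- exact: vanishes0.
- by rewrite /quot tofrac0 mul0r.
Qed.

Lemma nnull_neq0 f : ~ null X f -> f != 0.
Proof. by move=> nf; apply/eqP => f0; apply: nf; rewrite f0; exact: null0. Qed.

Lemma ratfunV f : ratfun X f -> ~ null X f -> ratfun X f^-1.
Proof.
move=> [d [F [G [Fd Gd nG ->]]]] nn; rewrite quotV.
by exists d, G, F; split=> // F0; apply: nn; exists d, F, G.
Qed.

(** A fraction that is not null is invertible among the rational functions, so it can be
    cancelled. *)
Lemma null_integral f h : ratfun X f -> null X (f * h) -> ~ null X f -> null X h.
Proof.
move=> rf nfh nf; rewrite -[h](mulKf (nnull_neq0 nf)).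
exact/nullMl/nfh/ratfunV.
Qed.

(** [null] provides only some presentation with vanishing numerator. Cross-multiplying and
    cancelling the other denominator by irreducibility transfers the vanishing to the given
    numerator. *)
Lemma null_quot d (F G : form) : F \is d.-homog -> G \is d.-homog ->
  ~ vanishes_on X G -> null X (quot F G) -> vanishes_on X F.
Proof.
move=> Fd Gd nG [e [A [B [Ae Be nB A0 E]]]].
have FB : F * B = A * G.
  apply/eqP; rewrite -tofrac_eq !rmorphM /=.
  by rewrite -eqr_div ?tofrac_eq0 ?nvanishes_neq0 //; apply/eqP.
have : vanishes_on X (F * B) by rewrite FB; exact: vanishes_mulr.
by case/(vanishes_mul Fd Be).
Qed.

Lemma eqX_refl f : eqX X f f.
Proof. by rewrite /eqX subrr; exact: null0. Qed.

Lemma eqX_sym f h : eqX X f h -> eqX X h f.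
Proof. by rewrite /eqX -[h - f]opprB => /nullN. Qed.

Lemma eqX_trans f h l : eqX X f h -> eqX X h l -> eqX X f l.
Proof. by move=> fh hl; rewrite /eqX -(subrKA h); exact: nullD. Qed.

Lemma eqXM f f' h h' : ratfun X h -> ratfun X f' ->
  eqX X f f' -> eqX X h h' -> eqX X (f * h) (f' * h').
Proof.
move=> rh rf' ff hh.
rewrite /eqX (_ : _ - _ = (f - f') * h + f' * (h - h')); last first.
  by rewrite mulrBl mulrBr subrKA.
by apply: nullD; [exact: nullMr | exact: nullMl].
Qed.

Lemma eqXD f f' h h' : eqX X f f' -> eqX X h h' -> eqX X (f + h) (f' + h').
Proof. by move=> ff hh; rewrite /eqX opprD addrACA; exact: nullD. Qed.

Lemma ratfun_eqX f h : eqX X f h -> ratfun X h -> ratfun X f.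
Proof. by move=> /null_ratfun fh rh; rewrite -(subrK h f); exact: ratfunD. Qed.

Lemma eqX_null f h : eqX X f h -> null X h -> null X f.
Proof. by move=> fh nh; rewrite -(subrK h f); exact: nullD. Qed.

(** * Values and regularity at a point *)

Section AtPoint.
Variable P : point.
Hypothesis XP : X P.

Lemma value_quot d (F G : form) : F \is d.-homog -> G \is d.-homog ->
  peval G P != 0 -> value_at X P (quot F G) (peval F P / peval G P).
Proof. by move=> Fd Gd GP; exists d, F, G; split=> //; exact: eqX_refl. Qed.

Lemma value_ratfun f c : value_at X P f c -> ratfun X f.
Proof.
move=> [d [F [G [Fd Gd GP fE _]]]]; apply: ratfun_eqX fE _.
by exists d, F, G; split=> //; exact: nvanishes_at GP.
Qed.

Lemma value_eqX f h c : eqX X f h -> value_at X P h c -> value_at X P f c.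
Proof.
move=> fh [d [F [G [Fd Gd GP hE ->]]]]; exists d, F, G; split=> //.
exact: eqX_trans hE.
Qed.

Lemma valueD f h b c :
  value_at X P f b -> value_at X P h c -> value_at X P (f + h) (b + c).
Proof.
move=> [d [F [G [Fd Gd GP fE ->]]]] [e [F' [G' [Fe Ge GP' hE ->]]]].
apply: value_eqX (eqXD fE hE) _.
have nG := nvanishes_at XP GP; have nG' := nvanishes_at XP GP'.
rewrite quotD ?nvanishes_neq0 // addf_div // -!pevalM -pevalD.
apply: (@value_quot (d + e)); rewrite ?dhomogM //.
- exact: homog_cross.
- by rewrite pevalM mulf_neq0.
Qed.

Lemma valueM f h b c :
  value_at X P f b -> value_at X P h c -> value_at X P (f * h) (b * c).
Proof.
move=> [d [F [G [Fd Gd GP fE ->]]]] [e [F' [G' [Fe Ge GP' hE ->]]]].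
have hr : value_at X P h (peval F' P / peval G' P) by exists e, F', G'.
apply: value_eqX (eqXM (value_ratfun hr) _ fE hE) _.
  exact: value_ratfun (value_quot Fd Gd GP).
rewrite quotM mulf_div -!pevalM.
by apply: (@value_quot (d + e)); rewrite ?dhomogM // pevalM mulf_neq0.
Qed.

Lemma value_cst c : value_at X P (cst c) c.
Proof.
have p1 : peval (1 : form) P = 1 by rewrite /peval meval1.
rewrite cst_quot; have := @value_quot 0 c%:MP 1 (homogC c) (dhomog1 _ _).
by rewrite p1 oner_neq0 divr1 /peval mevalC; apply.
Qed.

Lemma value_null f : null X f -> value_at X P f 0.
Proof.
move=> nf; apply: value_eqX (value_cst 0).
by rewrite /eqX /cst tofrac0 subr0.
Qed.

(** Values are defined through a choice of presentation; this is what makes them unique, by way of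
    [null_quot]. *)
Lemma value0_eq0 f c : null X f -> value_at X P f c -> c = 0.
Proof.
move=> nf [d [F [G [Fd Gd GP fE ->]]]].
rewrite (null_quot Fd Gd (nvanishes_at XP GP) _ XP) ?mul0r //.
exact: eqX_null (eqX_sym fE) nf.
Qed.

Lemma valueB f h b c :
  value_at X P f b -> value_at X P h c -> value_at X P (f - h) (b - c).
Proof.
move=> fb hc; have := valueD fb (valueM (value_cst (-1)) hc).
by rewrite mulN1r /cst !rmorphN !rmorph1 mulN1r.
Qed.

Lemma value_uniq f b c : value_at X P f b -> value_at X P f c -> b = c.
Proof.
move=> fb fc; apply/eqP; rewrite -subr_eq0; apply/eqP.
by apply: value0_eq0 (valueB fb fc); rewrite subrr; exact: null0.
Qed.

Lemma value_nnull f c : value_at X P f c -> c != 0 -> ~ null X f.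
Proof. by move=> fc c0 nf; rewrite (value0_eq0 nf fc) eqxx in c0. Qed.

Lemma valueV f c : value_at X P f c -> c != 0 -> value_at X P f^-1 c^-1.
Proof.
move=> fc c0; have nf := value_nnull fc c0; have rf := value_ratfun fc.
case: fc => d [F [G [Fd Gd GP fE cE]]].
have FP : peval F P != 0 by apply: contra c0 => /eqP F0; rewrite cE F0 mul0r.
have vFG := value_quot Fd Gd GP; rewrite -cE in vFG.
rewrite cE invf_div; apply: value_eqX (value_quot Gd Fd FP).
have nFG := value_nnull vFG c0.
rewrite -quotV /eqX subf_inv ?nnull_neq0 //.
apply: nullMr; first exact: nullN.
by apply: ratfunM; apply: ratfunV => //; exact: value_ratfun vFG.
Qed.

Lemma regularD f h : regular_at X P f -> regular_at X P h -> regular_at X P (f + h).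
Proof. by move=> [b fb] [c hc]; exists (b + c); exact: valueD. Qed.

Lemma regularM f h : regular_at X P f -> regular_at X P h -> regular_at X P (f * h).
Proof. by move=> [b fb] [c hc]; exists (b * c); exact: valueM. Qed.

Lemma regular_eqX f h : eqX X f h -> regular_at X P h -> regular_at X P f.
Proof. by move=> fh [c hc]; exists c; exact: value_eqX hc. Qed.

Lemma regular_null f : null X f -> regular_at X P f.
Proof. by move=> nf; exists 0; exact: value_null. Qed.

Lemma regular_ratfun f : regular_at X P f -> ratfun X f.
Proof. by case=> c /value_ratfun. Qed.

Lemma regularX f n : regular_at X P f -> regular_at X P (f ^+ n).
Proof.
move=> rf; elim: n => [|n IH]; last by rewrite exprS; exact: regularM.
by exists 1; have := value_cst 1; rewrite /cst !rmorph1.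
Qed.

End AtPoint.

(** * Uniformizers and orders at a point *)

Lemma ratfunX f n : ratfun X f -> ratfun X (f ^+ n).
Proof.
move=> rf; elim: n => [|n IH]; last by rewrite exprS; exact: ratfunM.
by have := ratfun_cst 1; rewrite /cst !rmorph1.
Qed.

Lemma ratfun_expz t (d : int) : ratfun X t -> ~ null X t -> ratfun X (t ^ d).
Proof.
move=> rt nt; case: d => n; first exact: ratfunX.
by rewrite NegzE -exprz_inv; apply/ratfunX/ratfunV.
Qed.

(** If the leading 1s stood at different indices i and j, the relation for i and j would read 1 = 0.
    Once they agree, the relation at that index compares all the other coordinates. *)
Lemma normalized_eq (P R : point) :
  (forall i j, val P i * val R j = val P j * val R i) -> P = R.
Proof.
move=> PR; apply: val_inj; apply/ffunP => l /=.
case: P R PR => p /= np [r /= nr] PR.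
case/existsP: np => i /andP[/eqP pi /forallP p0].
case/existsP: nr => j /andP[/eqP rj /forallP r0].
have [ij|ji|/val_inj E] := ltngtP i j.
- have /eqP ri := implyP (r0 i) ij.
  by have /eqP := PR i j; rewrite pi rj ri mulr0 mulr1 oner_eq0.
- have /eqP pj := implyP (p0 j) ji.
  by have /eqP := PR i j; rewrite pi rj pj mul0r mulr1 oner_eq0.
- by have := PR i l; rewrite pi E rj mul1r mulr1.
Qed.

(** The smaller set of a strict chain of length 1 is nonempty, so in a one-point [X] it would
    already be everything. *)
Lemma chain_neq_point (P : point) : closed_chain X 1 -> X P ->
  exists2 R, X R & R <> P.
Proof.
move=> [Z [Zc ZX Zlt]] XP; have [Z01 Z10] := Zlt 0%N isT.
apply: contrapT => noR.
have allP R : X R -> R = P by move=> XR; apply: contrapT => RP; apply: noR; exists R.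
have [[R Z0R] _] := (Zc 0%N isT).2; apply: Z10 => R' /(ZX 1%N isT) /allP ->.
by rewrite -(allP R) //; exact: (ZX 0%N isT).
Qed.

(** If t were null, every function vanishing at [P] would be null. Applied to (P_j x_i - P_i x_j) /
    x_l with P_l nonzero, this makes all points of [X] proportional to [P], whereas [X] has a second
    point. *)
Lemma uniformizer_nnull P t : closed_chain X 1 -> X P -> uniformizer X P t ->
  ~ null X t.
Proof.
move=> chainX XP [_ tP] nt; have [R XR] := chain_neq_point chainX XP; apply.
apply/esym/normalized_eq => i j.
have [l Pl] : exists l, val P l != 0.
  by case/existsP: (valP P) => l /andP[/eqP Pl _]; exists l; rewrite Pl oner_neq0.
pose F : form := val P j *: 'X_i - val P i *: 'X_j.
have F1 : F \is 1.-homog.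
  by rewrite /F dhomogD ?dhomogN ?dhomogZ // dhomogX /= mdeg1.
have X1 : ('X_l : form) \is 1.-homog by rewrite dhomogX /= mdeg1.
have pE R' : peval F R' = val P j * val R' i - val P i * val R' j.
  by rewrite /F /peval mevalB !mevalZ !mevalXU.
have Xl : peval 'X_l P != 0 by rewrite /peval mevalXU.
have := value_quot F1 X1 Xl; rewrite pE [val P i * _]mulrC subrr mul0r => /tP[h [rh]] E.
have nF : null X (quot F 'X_l).
  by apply: eqX_null E _; apply: nullMr nt _; exact: regular_ratfun rh.
have := null_quot F1 X1 (nvanishes_at XP Xl) nF XR; rewrite pE => /eqP.
by rewrite subr_eq0 eq_sym => /eqP.
Qed.

Lemma regular_expz P a (d : int) : X P ->
  regular_at X P a -> regular_at X P a^-1 -> regular_at X P (a ^ d).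
Proof.
move=> XP ra rV; case: d => n; first exact: regularX.
by rewrite NegzE -exprz_inv; exact: regularX.
Qed.

Hypothesis X_chain : closed_chain X 1.

Lemma uniformizer_ratfun P t : X P -> uniformizer X P t -> ratfun X t.
Proof. by move=> XP [/(value_ratfun XP)]. Qed.

Lemma uniformizer_div P t t' : X P -> uniformizer X P t -> uniformizer X P t' ->
  regular_at X P (t' / t).
Proof.
move=> XP ut [t'0 _]; have nt := uniformizer_nnull X_chain XP ut.
have rt := uniformizer_ratfun XP ut.
have [a [ra E]] := ut.2 _ t'0; apply: regular_eqX ra.
rewrite /eqX -[a](mulKf (nnull_neq0 nt)) [t^-1 * _]mulrC -mulrBl.
by apply: nullMr => //; exact: ratfunV.
Qed.

(** [val_ge] allows any uniformizer. Two of them divide each other in the local ring, so their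
    quotient is a unit there and a fixed t decides the order. *)
Lemma val_geE P t f d : X P -> uniformizer X P t ->
  val_ge X P f d <-> regular_at X P (f * t ^ (- d)).
Proof.
move=> XP ut; have nt := uniformizer_nnull X_chain XP ut.
have rt := uniformizer_ratfun XP ut; have t0 := nnull_neq0 nt.
split=> [[t' [h [ut' rh E]]] | rf]; last first.
  exists t, (f * t ^ (- d)); split=> //.
  rewrite mulrCA -expfzDr // subrr expr0z mulr1; exact: eqX_refl.
have nt' := uniformizer_nnull X_chain XP ut'.
have rt' := uniformizer_ratfun XP ut'.
have rth : regular_at X P ((t' / t) ^ d * h).
  apply: regularM rh => //; apply: regular_expz => //; first exact: uniformizer_div.
  by rewrite invf_div; exact: uniformizer_div.
apply: regular_eqX rth; rewrite expfzMl exprz_inv mulrAC.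
apply: eqXM (eqX_refl _) => //; first exact: ratfun_expz.
by apply: ratfunM; [exact: ratfun_expz | exact: regular_ratfun rh].
Qed.

(** * Riemann-Roch spaces and functions without poles *)

Hypothesis X_unif : forall P, X P -> exists t, uniformizer X P t.

Lemma RR_regular D f P t : X P -> uniformizer X P t -> RR X D f ->
  regular_at X P (f * t ^ coeff P D).
Proof. by move=> XP ut [_ /(_ P XP) /(val_geE _ _ XP ut)]; rewrite opprK. Qed.

Lemma RR_intro D f : ratfun X f ->
  (forall P t, X P -> uniformizer X P t -> regular_at X P (f * t ^ coeff P D)) ->
  RR X D f.
Proof.
move=> rf reg; split=> // P XP; have [t ut] := X_unif XP.
by apply/(val_geE _ _ XP ut); rewrite opprK; exact: reg.
Qed.

Lemma RRD D f h : RR X D f -> RR X D h -> RR X D (f + h).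
Proof.
move=> Df Dh; apply: RR_intro => [|P t XP ut].
  by apply: ratfunD; [case: Df | case: Dh].
by rewrite mulrDl; apply: regularD => //; exact: RR_regular.
Qed.

Lemma RRM D E f h : RR X D f -> RR X E h -> RR X (D + E) (f * h).
Proof.
move=> Df Eh; apply: RR_intro => [|P t XP ut].
  by apply: ratfunM; [case: Df | case: Eh].
have t0 := nnull_neq0 (uniformizer_nnull X_chain XP ut).
by rewrite coeffD expfzDr // mulrACA; apply: regularM => //; exact: RR_regular.
Qed.

Lemma RR_cst c : RR X 0 (cst c).
Proof.
apply: RR_intro => [|P t XP ut]; first exact: ratfun_cst.
by rewrite coeff0 expr0z mulr1; exists c; exact: value_cst.
Qed.

Lemma RRZ D c f : RR X D f -> RR X D (cst c * f).
Proof. by move=> Df; rewrite -[D]add0r; apply: RRM (RR_cst c) Df. Qed.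

Lemma uniformizer_divides P t f d : X P -> uniformizer X P t ->
  ratfun X f -> value_at X P (f * t ^ (d + 1)) 0 -> regular_at X P (f * t ^ d).
Proof.
move=> XP ut rf /(ut.2) [h [rh E]]; apply: regular_eqX rh.
have nt := uniformizer_nnull X_chain XP ut; have t0 := nnull_neq0 nt.
rewrite /eqX; have -> : f * t ^ d - h = t^-1 * (f * t ^ (d + 1) - t * h).
  by rewrite mulrBr mulKf // (addrC d) expfzDr // expr1z (mulrCA f) mulKf.
by apply: nullMl E; apply: ratfunV => //; exact: uniformizer_ratfun ut.
Qed.

(** A vanishing leading coefficient at [Q] lowers the allowed pole there by one; at the other points
    the two divisors agree. *)
Lemma RR_drop D f Q t : X Q -> uniformizer X Q t ->
  RR X (D + << Q >>) f -> value_at X Q (f * t ^ (coeff Q D + 1)) 0 -> RR X D f.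
Proof.
move=> XQ ut [rf Df] f0; split=> // P XP.
have [->|PQ] := eqVneq P Q.
  by apply/(val_geE _ _ XQ ut); rewrite opprK; exact: uniformizer_divides.
by have := Df P XP; rewrite coeffD coeffU eq_sym (negPf PQ) mulr0 addr0.
Qed.

Lemma null_sum (I : finType) (F : I -> frac) :
  (forall i, null X (F i)) -> null X (\sum_i F i).
Proof.
by move=> nF; apply: (big_ind (null X)) => //; [exact: null0 | exact: nullD].
Qed.

Lemma cstM (a b : K) : cst (N := N) (a * b) = cst a * cst b.
Proof. by rewrite /cst !rmorphM. Qed.

Lemma cst_sum (I : finType) (F : I -> K) :
  cst (N := N) (\sum_i F i) = \sum_i cst (F i).
Proof. by rewrite /cst !rmorph_sum. Qed.

(* Multiplication by f maps L(D) to itself, and an eigenvector of it shows that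
   f is constant. *)
Lemma regular_function_constant D l f : RR X 0 f -> RR_dim X D l.+1 ->
  exists c, eqX X f (cst c).
Proof.
move=> f0 [b [bRR bspan bfree]].
have /choice[M ME] i : exists c, eqX X (f * b i) (\sum_j cst (c j) * b j).
  by apply: bspan; rewrite -[D]add0r; exact: RRM.
pose A : 'M[K]_l.+1 := \matrix_(i, j) M i j.
have [a /eigenvalueP[v vA v0]] : exists a, eigenvalue A a.
  have /closed_rootP[a ra] : size (char_poly A) != 1%N by rewrite size_char_poly.
  by exists a; rewrite eigenvalue_root_char.
exists a; pose x := \sum_i cst (v 0 i) * b i.
have nx : ~ null X x.
  by move=> /bfree vi0; case/eqP: v0; apply/rowP => i; rewrite vi0 mxE.
have rx : ratfun X x.
  apply: (big_ind (ratfun X)) => [||i _]; [exact: null_ratfun null0|exact: ratfunD|].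
  by apply: ratfunM (ratfun_cst _) _; case: (bRR i).
apply: null_integral rx _ nx.
have -> : x * (f - cst a) = \sum_i cst (v 0 i) * (f * b i - \sum_j cst (M i j) * b j).
  rewrite mulrBr mulr_suml; under [RHS]eq_bigr do rewrite mulrBr.
  rewrite sumrB; congr (_ - _); first by apply: eq_bigr => i _; rewrite -mulrA (mulrC f).
  under [RHS]eq_bigr do rewrite mulr_sumr.
  rewrite exchange_big mulr_suml; apply: eq_bigr => j _ /=.
  under [RHS]eq_bigr do rewrite mulrA -cstM.
  rewrite -mulr_suml -cst_sum mulrAC -cstM; congr (cst _ * _).
  have /rowP/(_ j) := vA; rewrite !mxE mulrC => <-.
  by apply: eq_bigr => i _; rewrite mxE.
by apply: null_sum => i; apply: nullMl (ratfun_cst _) (ME i).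
Qed.

(** Let D attain the maximum that defines the genus. If L(D) is nonzero, f is constant by the
    previous lemma, and the constant is f(Q) = 0. If L(D) is zero, a neighbouring divisor is
    used. *)
Lemma regular_function_null g Q f : has_genus X g -> X Q -> RR X 0 f ->
  value_at X Q f 0 -> null X f.
Proof.
move=> [genus_ge [D [l [D_on Dl degD1]]]] XQ f0 fQ.
case: l Dl degD1 => [|l] Dl degD1; last first.
  have [c fc] := regular_function_constant f0 Dl.
  have c0 : c = 0.
    by apply: (value_uniq XQ (value_cst _ c)); apply: value_eqX fQ; exact: eqX_sym.
  by move: fc; rewrite c0 /eqX /cst !rmorph0 subr0.
have [t ut] := X_unif XQ.
have nullD0 h : RR X D h -> null X h.
  case: Dl => b [_ bspan _] /bspan[c]; rewrite big_ord0 /eqX subr0; exact: id.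
(* Since l(D) = 0, having l(D + Q) = 0 as well would exceed the maximum by one. So L(D + Q) has a
   nonzero h; as f vanishes at [Q], the product of f and h lies in L(D) = 0, and f is null. *)
pose D' := D + << Q >>.
have [h D'h nh] : exists2 h, RR X D' h & ~ null X h.
  apply: contrapT => no.
  have : RR_dim X D' 0.
    exists (fun=> 0); split=> [[]//|h D'h|c _ []//]; exists (fun=> 0).
    rewrite big_ord0 /eqX subr0; apply: contrapT => nh; apply: no; by exists h.
  have D'_on : divisor_on X D'.
    move=> P /domD_subset; rewrite mem_cat domU1 inE => /orP[/D_on //|/eqP -> //].
  by move/(genus_ge _ _ D'_on); rewrite /D' degD degU -degD1
    Num.Theory.lerD2r Num.Theory.gerDl Num.Theory.ler10.
apply: null_integral nh; first by case: D'h.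
apply: nullD0; apply: (RR_drop XQ ut).
  by rewrite mulrC -[X in RR _ X]add0r; exact: RRM.
have [c hc] := RR_regular XQ ut D'h.
move: hc; rewrite coeffD coeffU eqxx mulr1 => hc.
by rewrite (mulrC h) -mulrA -(mul0r c); exact: valueM.
Qed.

End FunctionField.

(** * Change of coefficients and the Frobenius *)

Section MapMpoly.
Variables (R S : comNzRingType) (f : {rmorphism R -> S}) (n : nat).

Lemma meval_map (v : 'I_n -> R) (w : 'I_n -> S) (F : {mpoly R[n]}) :
  (forall i, w i = f (v i)) -> (map_mpoly f F).@[w] = f F.@[v].
Proof.
move=> wE; elim/mpolyind: F => [|c m F _ _ IH]; first by rewrite !rmorph0.
rewrite !rmorphD /= IH map_mpolyZ map_mpolyX !mevalZ !mevalX rmorphM rmorph_prod.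
by congr (_ * _ + _); apply: eq_bigr => i _; rewrite wE rmorphXn.
Qed.

Lemma homog_map d (F : {mpoly R[n]}) :
  F \is d.-homog -> map_mpoly f F \is d.-homog.
Proof.
move=> /dhomogP Fd; apply/dhomogP => m; rewrite mcoeff_msupp mcoeff_map_mpoly => fm.
by apply: Fd; rewrite mcoeff_msupp; apply: contra fm => /eqP ->; rewrite raddf0.
Qed.

End MapMpoly.

Section Frobenius.
Variables (k : finFieldType) (K : closedFieldType) (iota : {rmorphism k -> K}).

(** The argument keeps the embedding of k in the term: the morphism instances below draw from it the
    characteristic of [K], hence the additivity of the power map. *)
Definition frobenius_of (_ : {rmorphism k -> K}) (x : K) : K := x ^+ #|k|.
Local Notation frobenius := (frobenius_of iota).

Lemma pchar_nat_card : [pchar K].-nat #|k|.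
Proof.
have [p pr_p chp] := finPcharP k.
have : p.-nat #|[set: k]%SET| by apply: abelem_pgroup; exact: fin_ring_pchar_abelem.
rewrite cardsT; apply: sub_in_pnat => r _ /[!inE] /eqP ->.
exact: rmorph_pchar iota _ chp.
Qed.

Lemma frobenius_is_zmod_morphism : zmod_morphism frobenius.
Proof.
move=> x y; apply: (canRL (addrK _)).
by rewrite /frobenius_of -(exprDn_pchar _ _ pchar_nat_card) subrK.
Qed.

Lemma frobenius_is_monoid_morphism : monoid_morphism frobenius.
Proof. by split=> [|x y]; rewrite /frobenius_of ?expr1n ?exprMn. Qed.

HB.instance Definition _ :=
  GRing.isZmodMorphism.Build K K frobenius frobenius_is_zmod_morphism.
HB.instance Definition _ :=
  GRing.isMonoidMorphism.Build K K frobenius frobenius_is_monoid_morphism.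

Lemma frobenius_iota a : frobenius (iota a) = iota a.
Proof. by rewrite /frobenius_of -rmorphXn expf_card. Qed.

(** Over k, the polynomial X^q - X is the product of all X - a, so its roots in [K] are the images
    of the elements of k. *)
Lemma frobenius_fixed c : frobenius c = c -> exists a, c = iota a.
Proof.
move=> fc; have : root (map_poly iota (\prod_(a : k) ('X - a%:P))) c.
  rewrite -finField_genPoly rmorphB /= map_polyXn map_polyX /root !hornerE.
  by rewrite -/(frobenius_of iota c) fc subrr.
rewrite rmorph_prod /root horner_prod prodf_seq_eq0 => /hasP[a _ /=].
by rewrite map_polyXsubC hornerXsubC subr_eq0 => /eqP ->; exists a.
Qed.

Lemma frobenius_surj c : exists b, frobenius b = c.
Proof.
have q0 : (0 < #|k|)%N by rewrite (cardD1 0) inE.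
have /closed_rootP[b] : size ('X^#|k| - c%:P) != 1%N.
  by rewrite size_XnsubC // eqSS -lt0n.
by rewrite /root !hornerE subr_eq0 => /eqP; exists b.
Qed.

End Frobenius.

(** * Functions defined over the finite field *)

Section RationalFunctions.
Variables (k : finFieldType) (K : closedFieldType) (iota : {rmorphism k -> K}).
Variables (N : nat) (s : seq {mpoly k[N.+1]}).

Local Notation X := (locus iota s).
Local Notation point := (proj_point K N).
Local Notation form := {mpoly K[N.+1]}.
Local Notation frac := {fraction {mpoly K[N.+1]}}.
Local Notation frob := (frobenius_of iota).
Local Notation lift F := (map_mpoly iota F).

Hypothesis X_irr : irreducible X.

(** Clearing denominators turns equality in the function field into vanishing of one form, on whose
    coefficients the Frobenius can act. *)
Lemma eqX_quot d e (F G F' G' : form) :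
  F \is d.-homog -> G \is d.-homog -> F' \is e.-homog -> G' \is e.-homog ->
  ~ vanishes_on X G -> ~ vanishes_on X G' ->
  eqX X (quot F G) (quot F' G') <-> vanishes_on X (F * G' - F' * G).
Proof.
move=> Fd Gd Fe Ge nG nG'.
have Fe' : - F' \is e.-homog by rewrite dhomogN.
have H1 := homog_cross Fd Gd Fe' Ge.
have H2 : G * G' \is (d + e).-homog by exact: dhomogM.
have nGG := nvanishes_mul X_irr Gd Ge nG nG'.
rewrite mulNr in H1.
rewrite /eqX quotN quotD ?(nvanishes_neq0 nG, nvanishes_neq0 nG') // mulNr.
split=> [nq|v].
  exact: (null_quot X_irr H1 H2 nGG nq).
by exists (d + e)%N, (F * G' - F' * G), (G * G').
Qed.

Lemma frob_lift (F : {mpoly k[N.+1]}) : map_mpoly frob (lift F) = lift F.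
Proof.
by apply/mpolyP => m; rewrite !mcoeff_map_mpoly /= [LHS]frobenius_iota.
Qed.

(** Take q-th roots of the coordinates. The Frobenius is injective and fixes 0, 1 and the
    coefficients of the equations, so the new point is normalized and lies on [X]. *)
Lemma frob_preimage (R : point) : X R ->
  exists2 R' : point, X R' & forall i, val R i = frob (val R' i).
Proof.
move=> XR; have /choice[r rE] i := frobenius_surj iota (val R i).
have rN : normalized [ffun i => r i].
  have /existsP[i /andP[/eqP Ri /forallP R0]] := valP R.
  apply/existsP; exists i; rewrite ffunE; apply/andP; split.
    by rewrite -(inj_eq (fmorph_inj frob)) rmorph1 -Ri; apply/eqP; exact: rE.
  apply/forallP => j; apply/implyP => ji; rewrite ffunE.
  by rewrite -(fmorph_eq0 frob) -(eqP (implyP (R0 j) ji)); apply/eqP; exact: rE.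
have RE i : val R i = frob (val (Sub _ rN : point) i) by rewrite SubK ffunE -rE.
exists (Sub _ rN) => // F Fs; apply/eqP; rewrite -(fmorph_eq0 frob).
rewrite /peval -(meval_map F RE); apply/eqP.
have /mapP[F0 _ FE] := Fs.
by rewrite FE frob_lift -FE; exact: XR.
Qed.

Lemma frob_vanishes (F : form) : vanishes_on X F -> vanishes_on X (map_mpoly frob F).
Proof.
move=> F0 R /frob_preimage[R' XR' RE].
by rewrite /peval (meval_map F RE) -/(peval F R') F0 ?rmorph0.
Qed.

(* The Frobenius x |-> x^q fixes f and Q, hence it fixes f(Q). *)
Lemma value_rational Q f c : rational_point iota X Q -> ratfun_over iota X f ->
  value_at X Q f c -> exists a, c = iota a.
Proof.
move=> [XQ Qk] [d [F [G [Fd Gd nG ->]]]] vc; apply: frobenius_fixed.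
have := vc; case=> e [F' [G' [Fe Ge GQ fE cE]]].
have QE i : val Q i = frob (val Q i).
  by have [a ->] := Qk i; rewrite [RHS]frobenius_iota.
have pE (A : form) : peval (map_mpoly frob A) Q = frob (peval A Q).
  exact: meval_map.
have nG' := nvanishes_at XQ GQ.
have fGQ : peval (map_mpoly frob G') Q != 0 by rewrite pE fmorph_eq0.
have /frob_vanishes : vanishes_on X (lift F * G' - F' * lift G).
  exact/(eqX_quot (homog_map iota Fd) (homog_map iota Gd) Fe Ge nG nG').
rewrite rmorphB !rmorphM /= !frob_lift => v.
have : eqX X (quot (lift F) (lift G)) (quot (map_mpoly frob F') (map_mpoly frob G')).
  apply/(eqX_quot (homog_map iota Fd) (homog_map iota Gd) (homog_map frob Fe)
           (homog_map frob Ge)) => //.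
  exact: nvanishes_at fGQ.
move=> E; have := value_quot X_irr (homog_map frob Fe) (homog_map frob Ge) fGQ.
move/(value_eqX X_irr E)/(value_uniq X_irr XQ vc) => vE.
by rewrite [RHS]vE !pE -fmorph_div -cE.
Qed.

Lemma ratfun_overD f h :
  ratfun_over iota X f -> ratfun_over iota X h -> ratfun_over iota X (f + h).
Proof.
move=> [d [F [G [Fd Gd nG ->]]]] [e [F' [G' [Fe Ge nG' ->]]]].
exists (d + e)%N, (F * G' + F' * G), (G * G'); split.
- by apply: dhomogD; [|rewrite addnC]; exact: dhomogM.
- exact: dhomogM.
- by rewrite rmorphM; exact: nvanishes_mul (homog_map _ Gd) (homog_map _ Ge) _ _.
- by rewrite rmorphD !rmorphM quotD ?(nvanishes_neq0 nG, nvanishes_neq0 nG').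
Qed.

Lemma ratfun_overM f h :
  ratfun_over iota X f -> ratfun_over iota X h -> ratfun_over iota X (f * h).
Proof.
move=> [d [F [G [Fd Gd nG ->]]]] [e [F' [G' [Fe Ge nG' ->]]]].
exists (d + e)%N, (F * F'), (G * G'); rewrite quotM !rmorphM.
split; [exact: dhomogM | exact: dhomogM | | by []].
exact: nvanishes_mul (homog_map _ Gd) (homog_map _ Ge) _ _.
Qed.

Lemma ratfun_over_cst a : ratfun_over iota X (cst (iota a)).
Proof.
have lift1 : lift 1 = 1 :> form by rewrite rmorph1.
exists 0%N, a%:MP, 1; rewrite lift1 map_mpolyC -cst_quot; split=> //.
- by rewrite -[a%:MP]mulr1 mul_mpolyC dhomogZ ?dhomog1.
- exact: dhomog1.
- exact: nvanishes1.
Qed.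

Lemma ratfun_overV f : ratfun_over iota X f -> ~ null X f ->
  ratfun_over iota X f^-1.
Proof.
move=> [d [F [G [Fd Gd nG ->]]]] nn; rewrite quotV; exists d, G, F; split=> // F0.
by apply: nn; exists d, (lift F), (lift G); split=> //; exact: homog_map.
Qed.

End RationalFunctions.

(** * One-point codes *)

Section OnePoint.
Variables (k : finFieldType) (K : closedFieldType) (iota : {rmorphism k -> K}).
Variables (N : nat) (s : seq {mpoly k[N.+1]}) (g : nat).

Local Notation X := (locus iota s).

Hypotheses (X_curve : is_curve iota s) (X_genus : has_genus X g).
Variables (n : nat) (Q : proj_point K N) (P : 'I_n -> proj_point K N).
Hypothesis Q_rational : rational_point iota X Q.
Hypothesis P_rational : forall i, rational_point iota X (P i).

Local Notation C := (one_point_code iota X Q P).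
Local Notation pole_le := (RR_point iota X Q).

Let X_irr : irreducible X. Proof. by case: X_curve. Qed.
Let X_chain : closed_chain X 1. Proof. by case: X_curve => _ _ [[]]. Qed.
Let X_unif R : X R -> exists t, uniformizer X R t.
Proof. by case: X_curve => _ _ [_]; exact. Qed.
Let XQ : X Q. Proof. by case: Q_rational. Qed.
Let XP i : X (P i). Proof. by case: (P_rational i). Qed.

Definition evaluates (f : {fraction {mpoly K[N.+1]}}) (x : 'rV[k]_n) :=
  forall i, value_at X (P i) f (iota (x 0 i)).

Lemma codeP m x : x \in C m <-> exists f, pole_le m f /\ evaluates f x.
Proof. by rewrite inE; split=> /asboolP. Qed.

Lemma pole_leD m f h : pole_le m f -> pole_le m h -> pole_le m (f + h).
Proof. by move=> [? ?] [? ?]; split; [exact: ratfun_overD | exact: RRD]. Qed.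

Lemma pole_leM a b f h : pole_le a f -> pole_le b h -> pole_le (a + b) (f * h).
Proof.
move=> [? ?] [? ?]; split; first exact: ratfun_overM.
by rewrite PoszD -freegUD; exact: RRM.
Qed.

Lemma pole_leZ m a f : pole_le m f -> pole_le m (cst (iota a) * f).
Proof.
move=> [? ?]; split; last exact: RRZ.
by apply: ratfun_overM => //; exact: ratfun_over_cst.
Qed.

Lemma pole_leS m f : pole_le m f -> pole_le m.+1 f.
Proof.
move=> [fk fm]; split=> //; have -> : << m.+1%:Z *g Q >> = << m%:Z *g Q >> + << Q >>.
  by rewrite freegUD -PoszD addn1.
(* The factor 1 is viewed as an element of L(Q). *)
rewrite -[f]mulr1.
apply: RRM => //; apply: RR_intro => // [|R t XR ut].
  by have := ratfun_cst X_irr 1; rewrite /cst !rmorph1.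
have t_reg : regular_at X R t by exists 0; case: ut.
rewrite mul1r coeffU mul1r; case: (Q == R); last first.
  by exists 1; have := value_cst X_irr R 1; rewrite /cst !rmorph1.
by rewrite expr1z.
Qed.

Lemma evaluatesD f h x y : evaluates f x -> evaluates h y -> evaluates (f + h) (x + y).
Proof. by move=> fx hy i; rewrite mxE rmorphD; exact: valueD. Qed.

Lemma evaluatesZ a f x : evaluates f x -> evaluates (cst (iota a) * f) (a *: x).
Proof. by move=> fx i; rewrite mxE rmorphM; apply: valueM => //; exact: value_cst. Qed.

Lemma evaluatesM f h x y :
  evaluates f x -> evaluates h y -> evaluates (f * h) (schur_mul x y).
Proof. by move=> fx hy i; rewrite mxE rmorphM; exact: valueM. Qed.

Lemma code_add m x y : x \in C m -> y \in C m -> x + y \in C m.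
Proof.
move=> /codeP[f [fm fx]] /codeP[h [hm hy]]; apply/codeP; exists (f + h).
by split; [exact: pole_leD | exact: evaluatesD].
Qed.

Lemma code_scale m a x : x \in C m -> a *: x \in C m.
Proof.
move=> /codeP[f [fm fx]]; apply/codeP; exists (cst (iota a) * f).
by split; [exact: pole_leZ | exact: evaluatesZ].
Qed.

Lemma code_0 m : 0 \in C m.
Proof.
apply/codeP; exists 0; split=> [|i]; last by rewrite mxE rmorph0; exact/value_null/null0.
split; first by have := ratfun_over_cst X_irr 0; rewrite rmorph0 /cst !rmorph0.
apply: RR_intro => // [|R t XR ut]; first exact/null_ratfun/null0.
by rewrite mul0r; exact/regular_null/null0.
Qed.

Lemma code_le m x : x \in C m -> x \in C m.+1.
Proof. by move=> /codeP[f [fm fx]]; apply/codeP; exists f; split=> //; exact: pole_leS. Qed.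

Lemma pred_code_add m x y : x \in pred_code C m -> y \in pred_code C m ->
  x + y \in pred_code C m.
Proof.
case: m => [|m]; last exact: code_add.
by rewrite !inE => /eqP -> /eqP ->; rewrite addr0.
Qed.

Lemma pred_code_scale m a x : x \in pred_code C m -> a *: x \in pred_code C m.
Proof.
case: m => [|m]; last exact: code_scale.
by rewrite !inE => /eqP ->; rewrite scaler0.
Qed.

(** * Leading coefficients at [Q] *)

Section Leading.
Variable t : {fraction {mpoly K[N.+1]}}.
Hypothesis ut : uniformizer X Q t.

(* c is the leading coefficient of f, seen as a function with a pole of order
   at most m at Q. *)
Definition leading m f c := value_at X Q (f * t ^ m%:Z) c.

Lemma leading_exists m f : pole_le m f -> exists c, leading m f c.
Proof.
move=> [_ fm]; have := RR_regular X_irr X_chain XQ ut fm.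
by rewrite coeffU eqxx mulr1.
Qed.

Lemma leadingM a b f h c d :
  leading a f c -> leading b h d -> leading (a + b) (f * h) (c * d).
Proof.
move=> fc hd; have t0 := nnull_neq0 X_irr (uniformizer_nnull X_irr X_chain XQ ut).
by rewrite /leading PoszD expfzDr // mulrACA; exact: valueM.
Qed.

(** For positive m the pole order drops by one. For m = 0 the function has no poles and vanishes at
    [Q], so it is null and its word is the zero word. *)
Lemma leading0_pred_code m f x : pole_le m f -> evaluates f x -> leading m f 0 ->
  x \in pred_code C m.
Proof.
case: m => [|m] [fk fm] fx f0 /=; last first.
  apply/codeP; exists f; split=> //; split=> //.
  apply: (RR_drop X_irr X_chain XQ ut).
    by rewrite freegUD -PoszD addn1.
  by rewrite coeffU eqxx mulr1 -PoszD addn1.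
have nf : null X f.
  apply: (regular_function_null X_irr X_chain X_unif X_genus XQ).
    by rewrite -(freegU0 _ Q).
  by move: f0; rewrite /leading expr0z mulr1.
rewrite inE; apply/eqP/rowP => i; rewrite mxE; apply/eqP.
rewrite -(fmorph_eq0 iota); apply/eqP.
exact: (value0_eq0 X_irr (XP i) nf (fx i)).
Qed.

(** The powers of t cancel in the quotient, so d / c is the value at the rational point [Q] of h /
    f, a function over the finite field. *)
Lemma leading_ratio m f h c d : pole_le m f -> pole_le m h ->
  leading m f c -> leading m h d -> c != 0 -> exists a, d / c = iota a.
Proof.
move=> [fk _] [hk _] fc hd c0.
have nft := value_nnull X_irr XQ fc c0.
have t0 := nnull_neq0 X_irr (uniformizer_nnull X_irr X_chain XQ ut).
have rt := uniformizer_ratfun X_irr XQ ut.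
have nf : ~ null X f.
  move=> nf; apply: nft; apply: nullMr => //; apply: ratfun_expz => //.
  exact: uniformizer_nnull XQ ut.
apply: (value_rational X_irr (Q := Q) (f := h / f)) => //.
  by apply: ratfun_overM => //; exact: ratfun_overV.
have -> : h / f = (h * t ^ m%:Z) / (f * t ^ m%:Z).
  by rewrite invfM mulrACA divff ?mulr1 // expfz_neq0.
by apply: valueM => //; exact: valueV.
Qed.

(** For any w in [C m], some multiple of x over k can be subtracted from w so as to cancel the
    leading coefficient. If x were in the predecessor, so would be every w, against the jump at
    m. *)
Lemma leading_notin m f x c : pole_le m f -> evaluates f x -> leading m f c ->
  c != 0 -> code_jump C m -> x \notin pred_code C m.
Proof.
move=> fm fx fc c0 /(code_jumpP code_0 code_le)[w /codeP[h [hm hw]]].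
apply: contra => xC.
have [d hd] := leading_exists hm.
have [a aE] := leading_ratio fm hm fc hd c0.
have lead0 : leading m (h + cst (iota (- a)) * f) 0.
  rewrite /leading mulrDl -mulrA -[0](subrr d) -{2}(divfK c0 d) aE -mulNr -rmorphN.
  by apply: valueD => //; apply: valueM => //; exact: value_cst.
have wE : w = (w + (- a) *: x) + a *: x by rewrite scaleNr subrK.
rewrite wE; apply: pred_code_add; last exact: pred_code_scale.
apply: leading0_pred_code lead0.
  by apply: pole_leD => //; exact: pole_leZ.
by apply: evaluatesD => //; exact: evaluatesZ.
Qed.

Lemma code_leading m x : x \in C m -> x \notin pred_code C m ->
  exists f c, [/\ pole_le m f, evaluates f x, leading m f c & c != 0].
Proof.
move=> /codeP[f [fm fx]] xnC; have [c fc] := leading_exists fm.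
exists f, c; split=> //; apply: contra xnC => /eqP c0.
by apply: leading0_pred_code fm fx _; rewrite -c0.
Qed.

End Leading.

Lemma code_mul a b x y :
  x \in C a -> x \notin pred_code C a -> y \in C b -> y \notin pred_code C b ->
  code_jump C (a + b) ->
  schur_mul x y \in C (a + b) /\ schur_mul x y \notin pred_code C (a + b).
Proof.
have [t ut] := X_unif XQ.
move=> xC xnC yC ynC jab.
have [f [c [fa fx fc c0]]] := code_leading ut xC xnC.
have [h [d [hb hy hd d0]]] := code_leading ut yC ynC.
have fhm := pole_leM fa hb; have fhxy := evaluatesM fx hy.
split; first by apply/codeP; exists (f * h).
apply: (leading_notin ut fhm fhxy (leadingM ut fc hd)) => //.
by rewrite mulf_neq0.
Qed.

Lemma mem_Hstar_seq m : (m \in Hstar_seq iota X Q P) = code_jump C m.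
Proof.
rewrite mem_sort; have [M leM] := code_jump_bounded code_add code_scale code_0 code_le.
(* Finiteness has to come first, because [fset_set] of an infinite set is empty. *)
have fin : cardinality.finite_set (fun m => is_true (Hstar iota X Q P m)).
  apply: cardinality.sub_finite_set (cardinality.finite_II M.+1) => j /leM.
  by rewrite /= ltnS.
rewrite (cardinality.in_fset_set fin).
by apply/idP/idP; rewrite classical_sets.inE.
Qed.

Lemma one_point_order_bound m : (dstar iota X Q P (code_dim (C m)) <= min_dist (C m))%N.
Proof.
apply: (order_bound code_add code_scale code_0 code_le code_mul) mem_Hstar_seq.
- exact/sort_sorted/leq_total.
- by rewrite sort_uniq finmap.fset_uniq.
Qed.

End OnePoint.

Theorem theorem3p6 (k : finFieldType) (K : closedFieldType)
    (iota : {rmorphism k -> K}) (K_algebraic : integralRange iota)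
    (N : nat) (s : seq {mpoly k[N.+1]}) (X_curve : is_curve iota s)
    (g : nat) (X_genus : has_genus (locus iota s) g)
    (n : nat) (n_large : (2 * g + 2 < n)%N)
    (Q : proj_point K N) (P : 'I_n -> proj_point K N)
    (Q_rational : rational_point iota (locus iota s) Q)
    (P_rational : forall i, rational_point iota (locus iota s) (P i))
    (P_distinct : injective P) (PQ_distinct : forall i, P i <> Q)
    (m : nat) :
  (dstar iota (locus iota s) Q P
     (code_dim (one_point_code iota (locus iota s) Q P m))
   <= min_dist (one_point_code iota (locus iota s) Q P m))%N.
Proof.
exact (one_point_order_bound X_curve X_genus Q_rational P_rational m).
Qed.
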